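(* Fix $\vartheta>0$ and let $I_n^{(\vartheta)}$ be the internal path length of a Hoppe tree with parameter $\vartheta$ and $n$ nodes. Then, as $n\to\infty$, \begin{align*} \mathbb{E}[I_n^{(\vartheta)}]&= (\vartheta+n-1)\sum_{i=1}^{n-1} \frac{1}{\vartheta+i} = n \log n -\Psi(\vartheta+1) n + o(n),\\ \mathrm{Var}(I_n^{(\vartheta)}) &= \left( \frac{2}{\vartheta+1} - \Psi_1(\vartheta+1)\right) n^2 + o(n^2). \end{align*} Moreover, $$\left( \frac{I_n^{(\vartheta)}-\mathbb{E}[I_n^{(\vartheta)}]}{\vartheta+n-1} \right)_{n\geq 1}$$ is a zero-mean martingale.
   Context: Hoppe tree with parameter $\vartheta>0$: the tree is grown by successive insertion of nodes, labelled $1,2,\ldots$ in order of insertion, all on one probability space (so the trees with $n=1,2,\ldots$ nodes form a growing sequence). Initially there is only the root. In each step a parent node is chosen among the existing nodes, independently of the past, with probability proportional to its weight, where the root has weight $\vartheta$ and every other node has weight $1$; a new node is attached as a child of the chosen node. The depth $D_i^{(\vartheta)}$ of node $i$ is its distance to the root, and the internal path length of the tree with $n$ nodes is $I_n^{(\vartheta)}=\sum_{i=1}^n D_i^{(\vartheta)}$. $\Psi=\frac{d}{dx}\log\Gamma$ is the digamma function and $\Psi_1=\frac{d^2}{dx^2}\log\Gamma$ the trigamma function. *)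

(* Defs.v *)
From HB Require Import structures.
From mathcomp Require Import all_boot all_order all_algebra.
From mathcomp Require Import all_classical all_reals all_analysis.
Set Implicit Arguments. Unset Strict Implicit. Unset Printing Implicit Defensive.
Import Order.TTheory GRing.Theory Num.Theory.
Import numFieldNormedType.Exports.
Local Open Scope classical_set_scope.
Local Open Scope ring_scope.

Section Special.
Variable R : realType.

Definition Gamma (x : R) : R :=
  \int[lebesgue_measure]_(t in `]0%R, +oo[) (powR t (x - 1) * expR (- t)).

Definition digamma : R -> R := derive1 (fun x => ln (Gamma x)).
Definition trigamma : R -> R := derive1 digamma.
End Special.

(* Hoppe tree.  Nodes are labelled 0,1,2,... (0 = root; the paper uses     *)
(* 1,2,3,... -- a pure relabelling).  Node k >= 1 chooses its parent p in  *)
(* {0,...,k-1} with probability weight th (if p = 0) or 1 (if p > 0),      *)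
(* normalised by the total weight th + (k-1), independently of the past.   *)
(* A history h = [:: p_1; ...; p_m] lists the parents of nodes 1..m and    *)
(* determines the tree with m+1 nodes; the growing sequence of trees lives *)
(* on the (discrete) space of infinite parent sequences, whose law on the  *)
(* first m coordinates is given by [hprob] below.                          *)
Section Hoppe.
Variables (R : realType) (th : R).

Definition hweight (k p : nat) : R :=
  if (p < k)%N then (if p == 0%N then th else 1) else 0.

Definition htrans (k p : nat) : R := hweight k p / (th + (k - 1)%:R).

Fixpoint histories (m : nat) : seq (seq nat) :=
  match m with
  | 0 => [:: [::]]
  | m'.+1 => [seq rcons h p | h <- histories m', p <- iota 0 m'.+1]
  end.

Definition hprob (h : seq nat) : R :=
  \prod_(i < size h) htrans i.+1 (nth 0%N h i).

Definition depths (h : seq nat) : seq nat :=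
  foldl (fun ds p => rcons ds (nth 0%N ds p).+1) [:: 0%N] h.

Definition ipl (h : seq nat) : nat := sumn (depths h).

Definition Exp (n : nat) (X : seq nat -> R) : R :=
  \sum_(h <- histories n.-1) hprob h * X h.

Definition EI (n : nat) : R := Exp n (fun h => (ipl h)%:R).
Definition VarI (n : nat) : R := Exp n (fun h => ((ipl h)%:R - EI n) ^+ 2).

Definition cond_next (n : nat) (Y : seq nat -> R) (h : seq nat) : R :=
  \sum_(p <- iota 0 n) htrans n p * Y (rcons h p).

(* (M_n)_{n>=1}, M_n a functional of the tree with n nodes, is a martingale *)
(* with respect to the natural filtration of the tree process (integrability*)
(* and adaptedness are automatic in this finite discrete setting; every     *)
(* history in [histories] has positive probability since th > 0).          *)
Definition hoppe_martingale (M : nat -> seq nat -> R) : Prop :=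
  forall n, (0 < n)%N -> forall h, h \in histories n.-1 ->
    cond_next n (M n.+1) h = M n h.

Definition Mproc (n : nat) (h : seq nat) : R :=
  ((ipl h)%:R - EI n) / (th + (n - 1)%:R).
End Hoppe.

(* Main.v *)
(* Attaching node n to a parent of depth d increases the path length by d + 1,
   and a parent is drawn with density proportional to the weights, the excess
   weight of the root being harmless because its depth is 0.  Hence the
   conditional expectations of the path length and of the sum of squared depths
   are affine in these two quantities, which yields the martingale property and
   first-order recursions for the mean and the variance with exact solutions in
   terms of the sums of (th + i)^-1 and (th + i)^-2, 1 <= i < n.

   These sums are matched with digamma and trigamma as in the Bohr-Mollerup
   theorem: g = ln Gamma is convex and g (x + 1) = g x + ln x, so the slopes of
   g near x + n are squeezed between ln (x + n - 1) and ln (x + n).  Translating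
   back by the functional equation shows that g is differentiable with
   g' x = lim (ln n - sum_(k < n) (x + k)^-1), and differentiating this once more
   gives the trigamma series. *)

Require Import Defs.
From HB Require Import structures.
From mathcomp Require Import all_boot all_order all_algebra.
From mathcomp Require Import all_classical all_reals all_analysis.
From mathcomp Require Import ring lra.
Import Order.TTheory GRing.Theory Num.Theory.
Import numFieldNormedType.Exports.
Local Open Scope classical_set_scope.
Local Open Scope ring_scope.

(** * Moments of the internal path length *)

Section HoppeMoments.
Context {R : realType} {th : R}.
Hypothesis th0 : 0 < th.
Implicit Types (h : seq nat) (n p : nat) (X Y : seq nat -> R).

Local Notation c n := (th + (n - 1)%:R).
Local Notation a n := (\sum_(1 <= i < n) (th + i%:R)^-1).
Local Notation b n := (\sum_(1 <= i < n) (th + i%:R) ^- 2).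

Lemma weight_gt0 n : 0 < c n.
Proof. by rewrite ltr_pwDl// ler0n. Qed.

Lemma weight_neq0 n : c n != 0.
Proof. by rewrite gt_eqF ?weight_gt0. Qed.

Lemma size_histories {m h} : h \in histories m -> size h = m.
Proof.
elim: m h => [|m IH] h; first by rewrite inE => /eqP->.
by move/allpairsPdep => [h1 [p [/IH <- _ ->]]]; rewrite size_rcons.
Qed.

Lemma depths_rcons h p :
  depths (rcons h p) = rcons (depths h) (nth 0%N (depths h) p).+1.
Proof. by rewrite /depths foldl_rcons. Qed.

Lemma size_depths h : size (depths h) = (size h).+1.
Proof. by elim/last_ind: h => // h p IH; rewrite depths_rcons !size_rcons IH. Qed.

Lemma head_depths h : depths h = 0%N :: behead (depths h).
Proof.
elim/last_ind: h => // h p IH; rewrite depths_rcons.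
by case: (depths h) IH => // d ds [->].
Qed.

Lemma ipl_rcons h p : ipl (rcons h p) = (ipl h + (nth 0%N (depths h) p).+1)%N.
Proof. by rewrite /ipl depths_rcons sumn_rcons. Qed.

Lemma iplE h : (ipl h)%:R = \sum_(d <- depths h) d%:R :> R.
Proof. by rewrite /ipl sumnE natr_sum. Qed.

(** Carried along because the conditional second moment of the next depth depends on it, so the
    variance recursion closes only with its mean. *)
Definition sq_depths h : R := \sum_(d <- depths h) d%:R ^+ 2.

Lemma sq_depths_rcons h p : sq_depths (rcons h p) =
  sq_depths h + (nth 0%N (depths h) p).+1%:R ^+ 2.
Proof. by rewrite /sq_depths depths_rcons big_rcons/= addrC. Qed.

(** The root comes first with depth [0] and weight [th], all other nodes have weight [1]: the
    weighted sum is the plain one plus [th - 1] further copies of the root term. *)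
Lemma htrans_sum h (F : nat -> R) (n := (size h).+1) :
  \sum_(p <- iota 0 n) htrans th n p * F (nth 0%N (depths h) p) =
  (\sum_(d <- depths h) F d + (th - 1) * F 0%N) / c n.
Proof.
have sz : size (behead (depths h)) = size h by rewrite size_behead size_depths.
have S : \sum_(p <- iota 1 (size h)) htrans th n p * F (nth 0%N (depths h) p) =
    (\sum_(d <- behead (depths h)) F d) / c n.
  rewrite (iotaDl 1 0) big_map [in RHS](big_nth 0%N) /index_iota subn0 sz mulr_suml.
  apply: eq_big_seq => i; rewrite mem_iota add0n => /andP[_ /= ilt].
  by rewrite (head_depths h)/= /htrans /hweight /n add1n ltnS ilt/=; ring.
rewrite /= big_cons S (head_depths h) !big_cons /=.
by rewrite /htrans /hweight /=; ring.
Qed.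

(* The root's excess weight [th - 1] contributes only to the constant term,
   since the root has depth [0]. *)
Lemma cond_next_quad {n h Y} (u v w : R) : (0 < n)%N -> h \in histories n.-1 ->
  (forall p, let d := (nth 0%N (depths h) p)%:R in
     Y (rcons h p) = u + v * d + w * d ^+ 2) ->
  cond_next th n Y h = u + (v * (ipl h)%:R + w * sq_depths h) / c n.
Proof.
case: n => // n _ /size_histories hn YE; rewrite /cond_next.
under eq_bigr do rewrite YE/=.
have := htrans_sum h (fun d => u + v * d%:R + w * d%:R ^+ 2).
rewrite hn => /= ->; rewrite 2!big_split/= -!mulr_sumr -iplE -/(sq_depths h).
rewrite big_const_seq count_predT iter_addr addr0 size_depths hn.
have := weight_neq0 n.+1; rewrite subn1/= => w0.
by rewrite -(mulr_natr u) -natr1; field.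
Qed.

Lemma hprob_rcons h p : hprob th (rcons h p) = hprob th h * htrans th (size h).+1 p.
Proof.
rewrite /hprob size_rcons big_ord_recr/= nth_rcons ltnn eqxx; congr (_ * _).
by apply: eq_bigr => i _; rewrite nth_rcons ltn_ord.
Qed.

(** Tower property: a history of [n] parents is one of [n.-1] parents followed by the choice of node
    [n], and [hprob] factors accordingly. *)
Lemma ExpS n X : (0 < n)%N -> Exp th n.+1 X = Exp th n (cond_next th n X).
Proof.
case: n => // n _; rewrite {1}/Exp [histories n.+1]/(allpairs_dep _ _ _) big_allpairs_dep.
apply: eq_big_seq => h /size_histories hn.
rewrite /cond_next mulr_sumr; apply: eq_bigr => p _.
by rewrite hprob_rcons hn mulrA.
Qed.

Lemma eq_Exp n X Y : {in histories n.-1, X =1 Y} -> Exp th n X = Exp th n Y.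
Proof. by move=> XY; apply: eq_big_seq => h /XY ->. Qed.

Lemma ExpD n X Y : Exp th n (fun h => X h + Y h) = Exp th n X + Exp th n Y.
Proof. by rewrite /Exp -big_split; apply: eq_bigr => h _; rewrite mulrDr. Qed.

Lemma ExpZ n k X : Exp th n (fun h => k * X h) = k * Exp th n X.
Proof. by rewrite /Exp mulr_sumr; apply: eq_bigr => h _; rewrite mulrCA. Qed.

Lemma Exp1 X : Exp th 1 X = X [::].
Proof. by rewrite /Exp /= big_seq1 /hprob /= big_ord0 mul1r. Qed.

Lemma Exp_cst n k : (0 < n)%N -> Exp th n (fun=> k) = k.
Proof.
elim: n => // -[|n] IH _; first by rewrite Exp1.
rewrite ExpS// -[RHS]IH//; apply: eq_Exp => h hin.
by rewrite (@cond_next_quad _ _ _ k 0 0)// => [|p /=]; ring.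
Qed.

Lemma cond_next_ipl n h : (0 < n)%N -> h \in histories n.-1 ->
  cond_next th n (fun h => (ipl h)%:R) h = 1 + c n.+1 / c n * (ipl h)%:R.
Proof.
move=> n0 hin; have := weight_neq0 n => w0.
rewrite (@cond_next_quad _ _ _ ((ipl h)%:R + 1) 1 0)//.
  by move: n0 w0; case: n {hin} => // n _; rewrite !subn1/= -natr1 => w0; field.
by move=> p /=; rewrite ipl_rcons natrD -natr1; ring.
Qed.

Lemma EI1 : EI th 1 = 0. Proof. by rewrite /EI Exp1. Qed.

Lemma EIS n : (0 < n)%N -> EI th n.+1 = 1 + c n.+1 / c n * EI th n.
Proof.
move=> n0; rewrite {1}/EI ExpS// (eq_Exp _ _ _ (fun h => cond_next_ipl _ _ n0)).
by rewrite ExpD ExpZ Exp_cst.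
Qed.

(** After division by [c n.+1], the recursion says that [EI / c] increases by [(th + n)^-1]. *)
Lemma EI_sum n : (0 < n)%N -> EI th n = c n * a n.
Proof.
elim: n => // -[_ _|n IH _]; first by rewrite EI1 big_geq ?mulr0.
rewrite EIS// IH// [in RHS]big_nat_recr//=.
have := weight_neq0 n.+1; have := weight_neq0 n.+2; rewrite !subn1/=.
by move=> w1 w0; field; rewrite nat1r w1 w0.
Qed.

(** With [x = (th + n)^-1], the mean divided by [c] increases by [(1 + 2 * a n) * x], while
    [a ^+ 2 - b] increases by exactly [2 * a n * x]. *)
Lemma sq_depths_mean n : (0 < n)%N ->
  Exp th n sq_depths = c n * (a n ^+ 2 + a n - b n).
Proof.
elim: n => // -[_ _|n IH _].
  by rewrite Exp1 /sq_depths /depths/= big_seq1 !big_geq//; ring.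
rewrite ExpS//.
transitivity (Exp th n.+1 (fun h => 1 + (2 / c n.+1 * (ipl h)%:R +
                                    (1 + (c n.+1)^-1) * sq_depths h))).
  apply: eq_Exp => h hin.
  rewrite (@cond_next_quad _ _ _ (sq_depths h + 1) 2 1)//; first by ring.
  by move=> p /=; rewrite sq_depths_rcons -natr1; ring.
rewrite ExpD Exp_cst// ExpD !ExpZ -/(EI th n.+1) IH// EI_sum//.
rewrite [in RHS]big_nat_recr//= [\sum_(1 <= i < n.+2) (th + i%:R) ^- 2]big_nat_recr//=.
have := weight_neq0 n.+1; have := weight_neq0 n.+2; rewrite !subn1/=.
by move=> w1 w0; field; rewrite nat1r w1 w0.
Qed.

Lemma Exp_sq_ipl n : (0 < n)%N ->
  Exp th n (fun h => (ipl h)%:R ^+ 2) = VarI th n + EI th n ^+ 2.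
Proof.
move=> n0; rewrite /VarI.
transitivity (Exp th n (fun h => ((ipl h)%:R - EI th n) ^+ 2 +
   (2 * EI th n * (ipl h)%:R + - EI th n ^+ 2))).
  by apply: eq_Exp => h _; ring.
by rewrite 2!ExpD ExpZ Exp_cst// -/(EI th n); ring.
Qed.

(** Law of total variance: the new deviation has conditional mean [c n.+1 / c n] times the old
    deviation, and its conditional variance is that of the parent depth,
    [sq_depths h / c n - (ipl h / c n) ^+ 2]. *)
Lemma VarIS n : (0 < n)%N -> VarI th n.+1 =
  (c n.+1 / c n) ^+ 2 * VarI th n
  + Exp th n sq_depths / c n - (VarI th n + EI th n ^+ 2) / c n ^+ 2.
Proof.
move=> n0; rewrite {1}/VarI ExpS//.
transitivity (Exp th n (fun h => (c n.+1 / c n) ^+ 2 * ((ipl h)%:R - EI th n) ^+ 2 +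
   ((c n)^-1 * sq_depths h + (- (c n)^-2) * (ipl h)%:R ^+ 2))).
  apply: eq_Exp => h hin; have w0 := weight_neq0 n.
  (* A parent of depth [d] makes the new deviation [u + d]. *)
  pose u := (ipl h)%:R + 1 - EI th n.+1.
  rewrite (@cond_next_quad _ _ _ (u ^+ 2) (2 * u) 1)//; last first.
    by move=> p /=; rewrite ipl_rcons natrD -natr1 /u; ring.
  rewrite /u EIS//; move: n0 w0; case: n {u hin} => // n _.
  by rewrite !subn1/= -natr1 => w0; field.
by rewrite 2!ExpD !ExpZ Exp_sq_ipl// -/(VarI th n); ring.
Qed.

(* The recursion for [v = VarI / c ^+ 2] reads
   [v n.+1 = (1 - x ^+ 2) * v n + (a n - b n) * x ^+ 2] with [x = (th + n)^-1];
   [(th + n - 1) / (th + n)] is an integrating factor. *)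
Lemma VarI_closed n : (0 < n)%N -> VarI th n = c n ^+ 2 *
  (a n + 1 - b n
   + (1 + (c n)^-1) * ((1 - th) / (1 + th) - a n - (c n.+1)^-1)).
Proof.
have t1 : 1 + th != 0 by rewrite gt_eqF// ltr_wpDl.
have t0 : th != 0 by rewrite gt_eqF.
elim: n => // -[_ _|n IH _].
  (* At [n = 1], where [c 1 = th], the constant [(1 - th) / (1 + th)] is the value for which the
     formula gives variance [0]. *)
  rewrite /VarI Exp1 EI1 !big_geq// subnn subn1/= /ipl/=.
  by field; rewrite addrC t1 t0.
rewrite VarIS// IH// EI_sum// sq_depths_mean//.
rewrite [\sum_(1 <= i < n.+2) (th + i%:R) ^- 1]big_nat_recr//=.
rewrite [\sum_(1 <= i < n.+2) (th + i%:R) ^- 2]big_nat_recr//=.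
have := weight_neq0 n.+1; have := weight_neq0 n.+2; have := weight_neq0 n.+3.
rewrite !subn1/=.
move=> w2 w1 w0; field. by rewrite nat1r -natrD t1 w2 w1 w0.
Qed.

(** Centering removes the constant [1], and dividing by the weight removes the factor
    [c n.+1 / c n], from the conditional mean of the path length. *)
Lemma Mproc_martingale : hoppe_martingale th (Mproc th).
Proof.
move=> n n0 h hin; have w0 := weight_neq0 n; have w1 := weight_neq0 n.+1.
rewrite (@cond_next_quad _ _ _ (((ipl h)%:R + 1 - EI th n.+1) / c n.+1) (c n.+1)^-1 0)//.
  rewrite /Mproc EIS//; move: n0 w0 w1; case: n {hin} => // n _.
  by rewrite !subn1/= -natr1 => w0 w1; field; rewrite w0 w1.
by move=> p /=; rewrite /Mproc ipl_rcons natrD -natr1; ring.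
Qed.

Lemma Mproc_mean n : (0 < n)%N -> Exp th n (Mproc th n) = 0.
Proof.
move=> n0; have w0 := weight_neq0 n.
transitivity (Exp th n (fun h => (c n)^-1 * (ipl h)%:R + - (EI th n / c n))).
  by apply: eq_Exp => h _; rewrite /Mproc; ring.
by rewrite ExpD ExpZ Exp_cst// -/(EI th n); field.
Qed.

End HoppeMoments.

(** * The Gamma integral *)

Section GammaFunction.
Context {R : realType}.
Implicit Types (x y t a b : R) (n : nat).

Local Notation mu := (@lebesgue_measure R).
Local Notation P x := (fun t : R => powR t x * expR (- t)).
Local Notation seg n := `[n.+2%:R^-1, n.+2%:R : R].

Lemma is_derive_gamma_density x t : 0 < t ->
  is_derive t 1 (P x) (x * (powR t (x - 1) * expR (- t)) - powR t x * expR (- t)).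
Proof.
move=> t0; have dp := @is_derive1_powR R x t t0; apply: is_derive_eq.
by rewrite /GRing.scale/=; ring.
Qed.

Lemma gamma_density_cvg x t : 0 < t -> P x z @[z --> t] --> P x t.
Proof.
move=> t0; have [d _] := is_derive_gamma_density x t t0.
by apply: (@differentiable_continuous _ _ _ t (P x)); exact/derivable1_diffP.
Qed.

Lemma within_gamma_density x a b : 0 < a -> {within `[a, b], continuous (P x)}.
Proof.
move=> a0; apply: continuous_in_subspaceT => t; rewrite inE/= in_itv/= => /andP[ta _].
exact/gamma_density_cvg/(lt_le_trans a0).
Qed.

Lemma integrable_gamma_density x a b : 0 < a ->
  mu.-integrable `[a, b] (EFin \o P x).
Proof.
move=> a0; apply: continuous_compact_integrable; first exact: segment_compact.
exact: within_gamma_density.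
Qed.

(** Integration by parts: [P x] is a primitive of [x * P (x - 1) - P x] away from [0]. *)
Lemma Rintegral_gamma_densityS x a b : 0 < a -> a < b ->
  (\int[mu]_(t in `[a, b]) P x t =
  x * \int[mu]_(t in `[a, b]) P (x - 1) t + P x a - P x b)%R.
Proof.
move=> a0 ab.
have := @continuous_FTC2 R (fun t => x * P (x - 1) t - P x t) (P x) a b ab.
have cf : {within `[a, b], continuous (fun t => x * P (x - 1) t - P x t)}.
  apply: continuous_in_subspaceT => t; rewrite inE/= in_itv/= => /andP[ta _].
  have t0 := lt_le_trans a0 ta.
  apply: cvgB; last exact: gamma_density_cvg.
  by apply: cvgM; [exact: cvg_cst|exact: gamma_density_cvg].
have dF : derivable_oo_LRcontinuous (P x) a b.
  split.
  - move=> t /[!in_itv]/= /andP[ta _].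
    by have [] := is_derive_gamma_density x t (lt_trans a0 ta).
  - exact/cvg_at_right_filter/gamma_density_cvg.
  - exact/cvg_at_left_filter/gamma_density_cvg/(lt_trans a0).
move=> /(_ cf dF) FTC.
have /FTC : {in `]a, b[, derive1 (P x) =1 (fun t => x * P (x - 1) t - P x t)}.
  move=> t /[!in_itv]/= /andP[ta _]; rewrite derive1E.
  by have [_ ->] := is_derive_gamma_density x t (lt_trans a0 ta).
move=> /(congr1 fine)/=; rewrite -/(Rintegral _ _ _) RintegralB//; last 2 first.
- apply: continuous_compact_integrable; first exact: segment_compact.
  apply: continuous_in_subspaceT => t; rewrite inE/= in_itv/= => /andP[ta _].
  apply: cvgM; first exact: cvg_cst.
  exact/gamma_density_cvg/(lt_le_trans a0).
- exact: integrable_gamma_density.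
rewrite RintegralZl//; last exact: integrable_gamma_density.
by move=> E; rewrite -[P x b](subrK (P x a)) -E; ring.
Qed.

(** Half of the exponential decay absorbs the power: [ln s < s] at [s = t / (2 * x)] gives
    [x * ln t <= x * ln (2 * x) + t / 2]. *)
Lemma gamma_density_le x t : 0 < x -> 0 < t ->
  P x t <= expR (x * ln (2 * x)) * expR (- (t / 2)).
Proof.
move=> x0 t0; rewrite /powR (gt_eqF t0) -!expRD ler_expR.
have x2 : 0 < 2 * x by lra.
have h : ln t - ln (2 * x) <= t / (2 * x).
  rewrite -ln_div ?posrE//; apply/ltW/ln_sublinear; exact: divr_gt0.
have : x * (ln t - ln (2 * x)) <= t / 2.
  apply: (le_trans (ler_wpM2l (ltW x0) h)).
  by rewrite le_eqVlt; apply/orP; left; apply/eqP; field; lra.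
lra.
Qed.

Lemma Rintegral_gamma_density_le x a b : 0 < x -> 0 < a -> a < b ->
  (\int[mu]_(t in `[a, b]) P x t <= 2 * expR (x * ln (2 * x)))%R.
Proof.
move=> x0 a0 ab; set K := expR _.
have K0 : 0 < K by exact: expR_gt0.
pose E t : R := - (2 * K) * expR (- (t / 2)).
pose f t : R := K * expR (- (t / 2)).
have dE t : is_derive t 1 E (f t).
  rewrite /E; apply: is_derive_eq.
  by rewrite /f /GRing.scale/=; field.
have cf t : {for t, continuous f}.
  apply: differentiable_continuous; apply/derivable1_diffP.
  exact: ex_derive.
have ce : {within `[a, b], continuous f}.
  by apply: continuous_in_subspaceT => t _; exact: cf.
have cE t : {for t, continuous E}.
  apply: differentiable_continuous; apply/derivable1_diffP.
  by have [] := dE t.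
have FTC : (\int[mu]_(t in `[a, b]) (f t)%:E = (E b)%:E - (E a)%:E)%E.
  apply: continuous_FTC2 => //.
    split; [by move=> t _; have [] := dE t| |].
    - exact/cvg_at_right_filter/cE.
    - exact/cvg_at_left_filter/cE.
  by move=> t _; rewrite derive1E; have [_ ->] := dE t.
apply: (@le_trans _ _ (\int[mu]_(t in `[a, b]) f t)).
  apply: le_Rintegral => //; first exact: integrable_gamma_density.
    by apply: continuous_compact_integrable => //; exact: segment_compact.
  move=> t /=; rewrite in_itv/= => /andP[ta _].
  exact/gamma_density_le/(lt_le_trans a0).
rewrite /Rintegral FTC /= /E.
have : 0 < 2 * K * expR (- (b / 2)) by rewrite !mulr_gt0 ?expR_gt0.
have : 2 * K * expR (- (a / 2)) <= 2 * K.
  by rewrite ler_piMr ?expR_le1//; lra.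
lra.
Qed.

Lemma seg_gt0 n : 0 < n.+2%:R^-1 :> R.
Proof. by rewrite invr_gt0. Qed.

Lemma seg_lt n : (n.+2%:R^-1 < n.+2%:R :> R).
Proof. by rewrite (@lt_trans _ _ 1)// ?invf_lt1// ltr1n. Qed.

(** The Gamma integral is reached through these segments, which are compact and avoid the possible
    singularity at [0]. *)
Lemma bigcup_seg : \bigcup_n [set` seg n] = `]0, +oo[%classic :> set R.
Proof.
apply/seteqP; split=> [t [n _] /=|t /=]; rewrite !in_itv/= ?andbT.
  by move=> /andP[+ _]; apply: lt_le_trans; rewrite invr_gt0.
(* An index beyond both [t] and [t^-1] handles the two endpoints at once. *)
move=> t0; pose n := Num.truncn (t + t^-1).
have nt : t + t^-1 < n.+2%:R.
  by rewrite (lt_trans (truncnS_gt _))// ltr_nat.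
have ti0 : 0 < t^-1 by rewrite invr_gt0.
exists n => //=; rewrite in_itv/= -[leRHS]invrK lef_pV2 ?posrE//.
by apply/andP; split; lra.
Qed.

Lemma gamma_density_ge0 x t : 0 <= P x t.
Proof. by rewrite mulr_ge0 ?powR_ge0 ?expR_ge0. Qed.

Lemma integral_gamma_density_cvg x :
  (\int[mu]_(t in [set` seg n]) (P x t)%:E)%E @[n --> \oo] -->
  (\int[mu]_(t in `]0%R, +oo[) (P x t)%:E)%E.
Proof.
rewrite -bigcup_seg; apply: ge0_nondecreasing_set_cvg_integral => //.
- apply/nondecreasing_seqP => n; apply/subsetPset => t /=.
  rewrite !in_itv/= => /andP[nt tn]; apply/andP; split.
    by apply: le_trans nt; rewrite lef_pV2 ?posrE// ler_nat.
  by apply: le_trans tn _; rewrite ler_nat.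
- move=> n; by have /integrableP[] := integrable_gamma_density x _ n.+2%:R (seg_gt0 n).
- by move=> n t _; rewrite lee_fin gamma_density_ge0.
Qed.

Lemma fine_seg_integral x n :
  (\int[mu]_(t in [set` seg n]) (P x t)%:E)%E =
  (\int[mu]_(t in [set` seg n]) P x t)%:E.
Proof.
rewrite /Rintegral fineK//; apply: integrable_fin_num => //.
exact/integrable_gamma_density/seg_gt0.
Qed.

(** The exponent [x - 1] may be negative, so integration by parts first raises it to [x]. Of the
    [3 * K], the integral contributes [2 * K] and the right boundary term [K]. *)
Lemma Rintegral_seg_le x : 0 < x -> exists M, forall n,
  \int[mu]_(t in [set` seg n]) P (x - 1) t <= M.
Proof.
move=> x0; set K := expR (x * ln (2 * x)); exists (3 * K / x) => n.
have a0 : 0 < n.+2%:R^-1 :> R by rewrite invr_gt0.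
have E := @Rintegral_gamma_densityS x _ _ a0 (seg_lt n).
have B := @Rintegral_gamma_density_le x _ _ x0 a0 (seg_lt n).
have C : P x n.+2%:R <= K.
  apply: (le_trans (gamma_density_le _ _ x0 _)) => //.
  by rewrite ler_piMr ?expR_ge0// expR_le1 oppr_le0 divr_ge0.
have := gamma_density_ge0 x n.+2%:R^-1.
by rewrite ler_pdivlMr//; rewrite E -/K in B; lra.
Qed.

Lemma integrable_Gamma x : 0 < x -> mu.-integrable `]0, +oo[ (EFin \o P (x - 1)).
Proof.
move=> x0; have cv := integral_gamma_density_cvg (x - 1).
have [M HM] := Rintegral_seg_le x x0.
apply/integrableP; split.
  rewrite -bigcup_seg; apply/measurable_fun_bigcup => // n.
  by have /integrableP[] := integrable_gamma_density (x - 1) _ n.+2%:R (seg_gt0 n).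
apply: (@le_lt_trans _ _ M%:E); last exact: ltry.
under eq_integral do rewrite /= ger0_norm ?gamma_density_ge0//.
apply: (cvge_to_le cv); apply: nearW => n.
by rewrite fine_seg_integral lee_fin.
Qed.

Lemma Gamma_cvg x : 0 < x ->
  \int[mu]_(t in [set` seg n]) P (x - 1) t @[n --> \oo] --> Gamma x.
Proof.
move=> x0; have cv := integral_gamma_density_cvg (x - 1).
have fin : (\int[mu]_(t in `]0%R, +oo[) (P (x - 1) t)%:E)%E \is a fin_num.
  by apply: integrable_fin_num => //; exact: integrable_Gamma.
rewrite -(fineK fin) in cv.
exact: fine_cvg cv.
Qed.

(** Limit of the integration by parts over the segments: both boundary terms vanish. *)
Lemma GammaS x : 0 < x -> Gamma (x + 1) = x * Gamma x.
Proof.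
move=> x0; have x10 : 0 < x + 1 by rewrite addr_gt0.
have l := Gamma_cvg _ x10; have r := Gamma_cvg _ x0.
have inv0 : n.+2%:R^-1 @[n --> \oo] --> (0 : R).
  by have := cvg_harmonic (R := R); rewrite -cvg_shiftS.
have Pa : P x n.+2%:R^-1 @[n --> \oo] --> (0 : R).
  apply: (@squeeze_cvgr _ _ _ _ (fun=> 0) (fun n => n.+2%:R^-1 `^ x)).
  - apply: nearW => n; rewrite gamma_density_ge0/=.
    by rewrite ler_piMr ?powR_ge0// expR_le1 oppr_le0 invr_ge0.
  - exact: cvg_cst.
  - have [+ _] := cvg_at_rightP (fun t : R => powR t x) 0 0.
    apply; first exact: powR_cvg0.
    by split => // n; exact: seg_gt0.
have Pb : P x n.+2%:R @[n --> \oo] --> (0 : R).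
  set K := expR (x * ln (2 * x)).
  apply: (@squeeze_cvgr _ _ _ _ (fun=> 0) (fun n => 2 * K * n.+2%:R^-1)).
  - apply: nearW => n; rewrite gamma_density_ge0/=.
    (* With [b = n.+2%:R], the remaining factor is at most [2 / b], since
       [expR (b / 2) >= b / 2]. *)
    apply: (le_trans (gamma_density_le _ _ x0 _)) => //; rewrite -/K.
    rewrite (mulrC 2) -mulrA ler_wpM2l ?expR_ge0// expRN.
    rewrite -[2]invrK -invfM lef_pV2 ?posrE ?expR_gt0//.
    by apply: le_trans (expR_ge1Dx _); lra.
  - exact: cvg_cst.
  - by rewrite -(mulr0 (2 * K)); apply: cvgM => //; exact: cvg_cst.
have : \int[mu]_(t in [set` seg n]) P x t @[n --> \oo] --> x * Gamma x + 0 - 0.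
  have -> : (fun n => \int[mu]_(t in [set` seg n]) P x t) = 
    (fun n => x * \int[mu]_(t in [set` seg n]) P (x - 1) t
              + P x n.+2%:R^-1 - P x n.+2%:R).
    apply/funext => n; apply: Rintegral_gamma_densityS; last exact: seg_lt.
    by rewrite invr_gt0.
  apply: cvgB => //; apply: cvgD => //; apply: cvgM => //; exact: cvg_cst.
rewrite subr0 addr0; move: l; rewrite addrK => l r'.
exact: (cvg_unique _ l r').
Qed.

Lemma Gamma_gt0 x : 0 < x -> 0 < Gamma x.
Proof.
(* [d] bounds the density from below on [[1, 2]], where [0 <= ln t <= 1] and [t <= 2]. *)
move=> x0; pose d := expR (- `|x - 1| - 2).
have sub : `[1, 2] `<=` (`]0, +oo[ : set R).
  by move=> t /=; rewrite !in_itv/= andbT => /andP[+ _]; exact: lt_le_trans.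
have I := integrable_Gamma x x0.
apply: (@lt_le_trans _ _ (\int[mu]_(t in `[1, 2]) d)).
  rewrite Rintegral_cst//=; rewrite lebesgue_measure_itv/= lte_fin ltr1n/=.
  by rewrite mulr_gt0 ?expR_gt0//; lra.
apply: (@le_trans _ _ (\int[mu]_(t in `[1, 2]) P (x - 1) t)).
  apply: le_Rintegral => //.
  - apply: continuous_compact_integrable; first exact: segment_compact.
    by apply: continuous_in_subspaceT => t _; exact: cvg_cst.
  - exact: integrable_gamma_density.
  move=> t /=; rewrite in_itv/= => /andP[t1 t2].
  have t0 : 0 < t by apply: lt_le_trans t1.
  rewrite /powR gt_eqF// -expRD ler_expR.
  have h : `|(x - 1) * ln t| <= `|x - 1|.
    rewrite normrM ler_piMr//.
    rewrite ger0_norm ?ln_ge0//.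
    have -> : t = 1 + (t - 1) by ring.
    by apply: (le_trans (le_ln1Dx _)); lra.
  have := ler_norm (- ((x - 1) * ln t)); rewrite normrN; lra.
rewrite /Gamma /Rintegral; apply: fine_le.
- by apply: integrable_fin_num => //; exact: integrable_gamma_density.
- exact: integrable_fin_num.
apply: ge0_subset_integral => //.
  by have /integrableP[] := I.
by move=> t _; rewrite lee_fin gamma_density_ge0.
Qed.

End GammaFunction.

(** * Logarithmic convexity of the Gamma function *)

Section LogConvexity.
Context {R : realType}.
Implicit Types (x y t p q u v : R).

Local Notation mu := (@lebesgue_measure R).
Local Notation P x := (fun t : R => powR t x * expR (- t)).
Local Notation lnGamma x := (ln (Gamma x)).

(** The tangent of [expR] at the mean [m] lies below the graph; its values at [u] and [v] average to
    [expR m]. *)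
Lemma expR_convex p q u v : 0 <= p -> 0 <= q -> p + q = 1 ->
  expR (p * u + q * v) <= p * expR u + q * expR v.
Proof.
move=> p0 q0 pq; set m := p * u + q * v.
have tangent w : expR m * (1 + w - m) <= expR w.
  by rewrite -[w in leRHS](subrKC m) (expRD m) ler_wpM2l ?expR_ge0// -addrA expR_ge1Dx.
have -> : expR m = p * (expR m * (1 + u - m)) + q * (expR m * (1 + v - m)).
  by rewrite /m (_ : q = 1 - p); [ring|lra].
by rewrite lerD// ler_wpM2l.
Qed.

Lemma integrable_scale d (T : measurableType d) (nu : measure T R) (D : set T)
    (k : R) (f : T -> R) : d.-measurable D ->
  nu.-integrable D (EFin \o f) -> nu.-integrable D (EFin \o (fun z => k * f z)).
Proof. by move=> mD; exact: integrableZl. Qed.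

Lemma integrable_add d (T : measurableType d) (nu : measure T R) (D : set T)
    (f g : T -> R) : d.-measurable D ->
  nu.-integrable D (EFin \o f) -> nu.-integrable D (EFin \o g) ->
  nu.-integrable D (EFin \o (fun z => f z + g z)).
Proof. by move=> mD; exact: integrableD. Qed.

Lemma Gamma_le_add (al be x y z : R) : 0 < x -> 0 < y -> 0 < z ->
  (forall t, 0 < t -> P (z - 1) t <= al * P (x - 1) t + be * P (y - 1) t) ->
  Gamma z <= al * Gamma x + be * Gamma y.
Proof.
move=> x0 y0 z0 le.
have Ix := integrable_Gamma x x0; have Iy := integrable_Gamma y y0.
have Jx : mu.-integrable `]0, +oo[ (EFin \o (fun t => al * P (x - 1) t)).
  exact: integrable_scale.
have Jy : mu.-integrable `]0, +oo[ (EFin \o (fun t => be * P (y - 1) t)).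
  exact: integrable_scale.
have <- : \int[mu]_(t in `]0, +oo[) (al * P (x - 1) t + be * P (y - 1) t) =
    al * Gamma x + be * Gamma y.
  rewrite RintegralD//; congr (_ + _); exact: RintegralZl.
apply: le_Rintegral => //.
- exact: integrable_Gamma.
- exact: integrable_add.
by move=> t /=; rewrite in_itv/= andbT => /le.
Qed.

(** Weighted Young inequality: convexity of [expR] at the logarithms of the two densities divided by
    [a] and [b]. *)
Lemma gamma_density_log_convex (a b p q x y t : R) : 0 < a -> 0 < b -> 0 < t ->
  0 <= p -> 0 <= q -> p + q = 1 ->
  let L := expR (p * ln a + q * ln b) in
  P (p * x + q * y - 1) t <= p * L / a * P (x - 1) t + q * L / b * P (y - 1) t.
Proof.
move=> a0 b0 t0 p0 q0 pq /=; set L := expR (p * ln a + q * ln b).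
have qE : q = 1 - p by rewrite -pq addrC addKr.
rewrite /powR gt_eqF// -!expRD.
have := expR_convex p q ((x - 1) * ln t - t - ln a) ((y - 1) * ln t - t - ln b) p0 q0 pq.
have -> : p * ((x - 1) * ln t - t - ln a) + q * ((y - 1) * ln t - t - ln b) =
    (p * x + q * y - 1) * ln t - t - (p * ln a + q * ln b) by rewrite qE; ring.
rewrite (expRB _ (_ + _)) (expRB _ (ln a)) (expRB _ (ln b)) lnK ?posrE// lnK ?posrE// -/L => h.
have L0 : 0 < L by exact: expR_gt0.
move: h; rewrite ler_pdivrMr// => /le_trans; apply.
by rewrite le_eqVlt; apply/orP; left; apply/eqP; ring.
Qed.

(** Hölder's inequality: for [a = Gamma x] and [b = Gamma y] the integrated Young bound is
    [(p + q) * L = L]. *)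
Lemma lnGamma_convex p q x y : 0 < x -> 0 < y -> 0 <= p -> 0 <= q -> p + q = 1 ->
  lnGamma (p * x + q * y) <= p * lnGamma x + q * lnGamma y.
Proof.
move=> x0 y0 p0 q0 pq.
have z0 : 0 < p * x + q * y.
  have [pn|pn] := eqVneq p 0.
    by move: pq; rewrite pn add0r mul0r add0r => ->; rewrite mul1r.
  by rewrite ltr_pwDl ?mulr_gt0// ?mulr_ge0 ?(ltW y0)// lt_def pn.
have Gz := Gamma_gt0 _ z0; rewrite -ler_expR lnK ?posrE//.
have := Gamma_le_add _ _ _ _ _ x0 y0 z0
  (fun t ht => gamma_density_log_convex _ _ _ _ _ _ _
                 (Gamma_gt0 _ x0) (Gamma_gt0 _ y0) ht p0 q0 pq).
have a0 := lt0r_neq0 (Gamma_gt0 _ x0); have b0 := lt0r_neq0 (Gamma_gt0 _ y0).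
by rewrite /= (mulfVK a0) (mulfVK b0) -mulrDl pq mul1r.
Qed.

Lemma lnGammaS x : 0 < x -> lnGamma (x + 1) = lnGamma x + ln x.
Proof. by move=> x0; rewrite GammaS// lnM ?posrE ?Gamma_gt0// addrC. Qed.

End LogConvexity.

(** * Log-convex solutions of the Gamma equation *)

Section LogConvexDifferenceEquation.
Context {R : realType} (g : R -> R).
Implicit Types (x y t h p q u v : R) (n k : nat).

Hypothesis gS : forall x, 0 < x -> g (x + 1) = g x + ln x.
Hypothesis g_convex : forall p q x y, 0 < x -> 0 < y -> 0 <= p -> 0 <= q ->
  p + q = 1 -> g (p * x + q * y) <= p * g x + q * g y.

(** By convexity the slope lies between those over [[x - 1, x]] and [[x, x + 1]], which the
    functional equation evaluates. *)
Lemma slope_bounds x h : 1 < x -> h != 0 -> `|h| <= 1 ->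
  ln (x - 1) <= h^-1 * (g (h + x) - g x) <= ln x.
Proof.
move=> x1 h0 h1.
have xm0 : 0 < x - 1 by lra.
have x0 : 0 < x by lra.
have xp0 : 0 < x + 1 by lra.
have Sm := gS _ xm0; have Sp := gS _ x0; rewrite subrK in Sm.
have Lm : ln (x - 1) = g x - g (x - 1) by lra.
have Lp : ln x = g (x + 1) - g x by lra.
clear Sm Sp.
have [hp|hn|h00] := ltgtP 0 h; last by rewrite -h00 eqxx in h0.
- have hle : h <= 1 by rewrite gtr0_norm in h1.
  have hx0 : 0 < h + x by lra.
  rewrite mulrC ler_pdivlMr// ler_pdivrMr//.
  (* Upper bound: [h + x] lies between [x] and [x + 1]. Lower bound: [x] lies between [x - 1] and
     [h + x]. *)
  have := @g_convex (1 - h) h x (x + 1) x0 xp0.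
  rewrite (_ : (1 - h) * x + h * (x + 1) = h + x); last by ring.
  have := @g_convex (h / (1 + h)) (1 / (1 + h)) (x - 1) (h + x) xm0 hx0.
  rewrite (_ : h / (1 + h) * (x - 1) + 1 / (1 + h) * (h + x) = x); last by field; lra.
  rewrite divr_ge0 ?divr_ge0//; try lra.
  rewrite -mulrDl addrC divff; last by lra.
  move=> /(_ erefl erefl erefl).
  rewrite [_ / _ * _]mulrAC [1 / _ * _]mulrAC -mulrDl ler_pdivlMr; last by lra.
  move=> A /(_ ltac:(lra) ltac:(lra) ltac:(lra)) B.
  by rewrite Lm Lp; apply/andP; split; lra.
(* Mirror image of the previous case, with the two bounds exchanged. *)
- pose k := - h; have kh : h = - k by rewrite /k opprK.
  have k0 : 0 < k by rewrite /k oppr_gt0.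
  have hle : k <= 1 by rewrite /k -ltr0_norm.
  have hx0 : 0 < x - k by lra.
  rewrite kh (_ : (- k)^-1 * _ = (g x - g (- k + x)) / k); last by field; lra.
  rewrite (addrC (- k)) ler_pdivlMr// ler_pdivrMr//.
  have := @g_convex (1 - k) k x (x - 1) x0 xm0.
  rewrite (_ : (1 - k) * x + k * (x - 1) = x - k); last by ring.
  have := @g_convex (1 / (1 + k)) (k / (1 + k)) (x - k) (x + 1) hx0 xp0.
  rewrite (_ : 1 / (1 + k) * (x - k) + k / (1 + k) * (x + 1) = x); last by field; lra.
  rewrite divr_ge0 ?divr_ge0//; try lra.
  rewrite -mulrDl divff; last by lra.
  move=> /(_ erefl erefl erefl).
  rewrite !(mulrAC _ (1 + k)^-1) -mulrDl ler_pdivlMr; last by lra.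
  move=> A /(_ ltac:(lra) ltac:(lra) ltac:(lra)) B.
  by rewrite Lm Lp; apply/andP; split; lra.
Qed.

Lemma translate_eq n x : 0 < x ->
  g (x + n%:R) = g x + \sum_(0 <= k < n) ln (x + k%:R).
Proof.
move=> x0; elim: n => [|n IH]; first by rewrite big_geq// !addr0.
rewrite big_nat_recr//= addrA -IH -natr1 addrA gS//.
by rewrite ltr_pwDl.
Qed.

Local Notation T n x := (\sum_(0 <= k < n) (x + k%:R)^-1).

Lemma ln_slope_cvg x : 0 < x -> h^-1 * (ln (h + x) - ln x) @[h --> 0^'] --> x^-1.
Proof.
move=> x0; have [dl <-] := is_derive1_ln x0.
suff <- : (fun h : R => h^-1 *: ((@ln R \o shift x) (h *: (1 : R)) - ln x)) =
  (fun h => h^-1 * (ln (h + x) - ln x)) by exact: dl.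
by apply/funext => h /=; rewrite [h *: 1]mulr1.
Qed.

Lemma ln_slope_sum_cvg n x : 0 < x ->
  \sum_(0 <= k < n) h^-1 * (ln (h + (x + k%:R)) - ln (x + k%:R)) @[h --> 0^']
  --> T n x.
Proof.
move=> x0; elim: n => [|n IH].
  by rewrite big_geq//; under eq_fun do rewrite big_geq//; exact: cvg_cst.
rewrite big_nat_recr//=; under eq_fun do rewrite big_nat_recr//=.
by apply: cvgD => //; apply: ln_slope_cvg; rewrite ltr_pwDl.
Qed.

(* Moving the slope of [g] far to the right makes it computable up to
   [ln (x + n) - ln (x + n - 1)], which gives differentiability of [g]. *)
Lemma slope_translate n x h : 0 < x -> 0 < h + x ->
  h^-1 * (g (h + x) - g x) = h^-1 * (g (h + (x + n%:R)) - g (x + n%:R)) -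
    \sum_(0 <= k < n) h^-1 * (ln (h + (x + k%:R)) - ln (x + k%:R)).
Proof.
move=> x0 hx0; rewrite addrA !translate_eq// -mulr_sumr sumrB.
by under [X in _ = _ - _ * (X - _)]eq_bigr do rewrite addrA; ring.
Qed.

(** The slope bounds are applied at [x + n.+1], which exceeds [1]; [e] absorbs the error of the
    finite sum of logarithmic slopes. *)
Lemma slope_near n x (e : R) : 0 < x -> 0 < e -> \forall h \near 0^',
  ln (x + n%:R) - T n.+1 x - e <= h^-1 * (g (h + x) - g x) <=
  ln (x + n.+1%:R) - T n.+1 x + e.
Proof.
move=> x0 e0; have /cvgrPdist_le/(_ e e0) S := ln_slope_sum_cvg n.+1 x x0.
near=> h.
have h0 : h != 0 by near: h; exact: nbhs_dnbhs_neq.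
have h1 : `|h| <= 1 by near: h; exact: dnbhs0_le.
have hx : `|h| < x by near: h; exact: dnbhs0_lt.
have hx0 : 0 < h + x by have := ler_norm (- h); rewrite normrN; lra.
rewrite (slope_translate n.+1)//.
have xn1 : 1 < x + n.+1%:R by rewrite -natr1; have : 0 <= n%:R :> R by []; lra.
have := slope_bounds _ _ xn1 h0 h1.
rewrite (_ : x + n.+1%:R - 1 = x + n%:R); last by rewrite -natr1; ring.
have : `|T n.+1 x - \sum_(0 <= k < n.+1) h^-1 * (ln (h + (x + k%:R)) - ln (x + k%:R))| <= e.
  by near: h.
rewrite ler_norml => /andP[S1 S2] /andP[B1 B2].
by apply/andP; split; lra.
Unshelve. all: by end_near. Qed.

(** The limit is not known in advance, so the Cauchy criterion is used: the bounds near [0] differ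
    by a logarithmic gap that shrinks with [n], plus an arbitrarily small error. *)
Lemma slope_cvg x : 0 < x -> cvg (h^-1 * (g (h + x) - g x) @[h --> 0^']).
Proof.
move=> x0; apply: cauchy_cvg; apply: cauchy_exP => e e0.
(* Makes the gap, at most [(x + n.+1%:R)^-1], smaller than [e / 2]; the other half of [e] goes to
   the error. *)
pose n := Num.truncn (2 / e).
have n2 : 2 / e < n.+1%:R by exact: truncnS_gt.
exists (ln (x + n.+1%:R) - T n.+2 x).
have e2 : 0 < e / 2 by rewrite divr_gt0.
apply: (@filterS _ (0 : R)^' _ _ _ _ (slope_near n.+1 _ _ x0 e2)) => h.
have xn : 0 < x + n.+1%:R by rewrite ltr_pwDl.
have : ln (x + n.+2%:R) - ln (x + n.+1%:R) < e / 2.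
  rewrite -ln_div ?posrE ?ltr_pwDl//.
  rewrite (_ : (x + n.+2%:R) / (x + n.+1%:R) = 1 + (x + n.+1%:R)^-1); last first.
    by rewrite -(natr1 n.+1); field; rewrite nat1r gt_eqF.
  apply: le_lt_trans (le_ln1Dx _) _.
    by rewrite (@lt_trans _ _ 0) ?ltrN10 ?invr_gt0.
  rewrite -[e / 2]invrK ltf_pV2 ?posrE ?invr_gt0// invf_div; lra.
rewrite -ball_normE/= ltr_norml => A /andP[B C].
by apply/andP; split; lra.
Qed.

Lemma derive1_between_ln_sums n x : 0 < x ->
  ln (x + n%:R) - T n.+1 x <= derive1 g x <= ln (x + n.+1%:R) - T n.+1 x.
Proof.
move=> x0; have cv := slope_cvg _ x0.
apply/andP; split.
  apply/ler_addgt0Pr => e e0; rewrite -lerBlDr; apply: limr_ge => //.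
  by apply: filterS (slope_near n _ _ x0 e0) => h /andP[].
apply/ler_addgt0Pr => e e0; apply: limr_le => //.
by apply: filterS (slope_near n _ _ x0 e0) => h /andP[].
Qed.

Lemma ln_shift_cvg x : 0 < x -> ln (x + n%:R) - ln n.+1%:R @[n --> \oo] --> (0 : R).
Proof.
move=> x0; rewrite -ln1.
have -> : (fun n => ln (x + n%:R) - ln n.+1%:R) =
          @ln R \o (fun n => 1 + (x - 1) * n.+1%:R^-1).
  apply/funext => n /=; rewrite -ln_div ?posrE ?ltr_pwDl//; congr ln.
  by rewrite -natr1; field; rewrite natr1.
apply: continuous_cvg; first exact: continuous_ln.
rewrite -[X in _ --> X]addr0 -(mulr0 (x - 1)).
apply: cvgD; first exact: cvg_cst.
by apply: cvgM; [exact: cvg_cst|exact: cvg_harmonic].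
Qed.

Lemma ln_inv_sum_cvg x : 0 < x -> T n x - ln n%:R @[n --> \oo] --> - derive1 g x.
Proof.
(* The shift pairs the [n.+1] terms of the bounds with [ln n.+1%:R]. *)
move=> x0; rewrite -cvg_shiftS/=.
apply: (@squeeze_cvgr _ _ _ _
  (fun n => - derive1 g x + (ln (x + n%:R) - ln n.+1%:R))
  (fun n => - derive1 g x + (ln (x + 1 + n%:R) - ln n.+1%:R))).
- apply: nearW => n; have := derive1_between_ln_sums n x x0.
  rewrite -addrA nat1r => /andP[A B].
  by apply/andP; split; lra.
- rewrite -[X in _ --> X]addr0; apply: cvgD; first exact: cvg_cst.
  exact: ln_shift_cvg.
- rewrite -[X in _ --> X]addr0; apply: cvgD; first exact: cvg_cst.
  by apply: ln_shift_cvg; rewrite addr_gt0.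
Qed.

End LogConvexDifferenceEquation.

(** * The series of inverse squares and termwise differentiation *)

Section SquareSeries.
Context {R : realType}.
Implicit Types (x y h : R) (n k : nat).

Local Notation T n x := (\sum_(0 <= k < n) (x + k%:R)^-1).
Local Notation U n x := (\sum_(0 <= k < n) (x + k%:R) ^- 2).

(* Telescoping: [(y + 1) ^- 2 <= y^-1 - (y + 1)^-1]. *)
Lemma inv_sq_sum_le n x : 0 < x -> U n.+1 x + (x + n%:R)^-1 <= x ^- 2 + x^-1.
Proof.
move=> x0; elim: n => [|n IH]; first by rewrite big_nat1 addr0.
apply: le_trans IH; rewrite big_nat_recr//= -addrA lerD2l.
have y0 : 0 < x + n%:R by rewrite ltr_pwDl.
rewrite -natr1 addrA; move: (x + n%:R) y0 => y y0.
have y1 : 0 < y + 1 by lra.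
have -> : y^-1 = (y + 1) ^- 2 + (y + 1)^-1 + (y * (y + 1) ^+ 2)^-1.
  by field; rewrite !gt_eqF.
by rewrite lerDl invr_ge0 mulr_ge0// ?sqr_ge0// ltW.
Qed.

Lemma inv_sq_sum_nondecreasing x : nondecreasing_seq (fun n => U n x).
Proof.
by apply/nondecreasing_seqP => n; rewrite big_nat_recr//= lerDl invr_ge0 sqr_ge0.
Qed.

Lemma inv_sq_sum_is_cvg x : 0 < x -> cvg (U n x @[n --> \oo]).
Proof.
move=> x0; apply: nondecreasing_is_cvgn; first exact: inv_sq_sum_nondecreasing.
exists (x ^- 2 + x^-1) => _ [n _ <-].
apply: (@le_trans _ _ (U n.+1 x)); first exact: inv_sq_sum_nondecreasing.
apply: le_trans (inv_sq_sum_le n x x0).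
by rewrite lerDl invr_ge0 addr_ge0// ltW.
Qed.

(** Each term has error [h / ((h + y) * y ^+ 2)] with [y = x + k%:R] and [h + y >= x / 2]. The
    constant [2 / x] is uniform in [n]. *)
Lemma inv_sum_slope n x h : 0 < x -> h != 0 -> `|h| <= x / 2 ->
  `|U n x - h^-1 * (T n x - T n (h + x))| <= `|h| * (2 / x) * U n x.
Proof.
move=> x0 h0 hx; rewrite -sumrB mulr_sumr -sumrB mulr_sumr.
apply: le_trans (ler_norm_sum _ _ _) _; apply: ler_sum => k _.
have k0 : 0 <= k%:R :> R by [].
move: hx; rewrite ler_norml => /andP[h1 h2].
have y0 : 0 < x + k%:R by lra.
have z0 : x / 2 <= h + x + k%:R by lra.
have z0' : 0 < h + x + k%:R by lra.
have -> : (x + k%:R) ^- 2 - h^-1 * ((x + k%:R)^-1 - (h + x + k%:R)^-1) =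
    h * (h + x + k%:R)^-1 * (x + k%:R) ^- 2.
  by field; rewrite h0 !gt_eqF.
have w0 : 0 <= (x + k%:R) ^- 2 by rewrite invr_ge0 sqr_ge0.
rewrite normrM (ger0_norm w0) ler_wpM2r// normrM ler_wpM2l//.
rewrite gtr0_norm ?invr_gt0// -[2 / x]invrK invf_div.
by rewrite lef_pV2 ?posrE// divr_gt0.
Qed.

(** Limit and derivative are exchanged by letting [n] tend to infinity in the uniform slope estimate
    before [h] tends to [0]. *)
Lemma derive1_inv_sum (psi : R -> R) :
  (forall x, 0 < x -> T n x - ln n%:R @[n --> \oo] --> - psi x) ->
  forall x, 0 < x -> U n x @[n --> \oo] --> derive1 psi x.
Proof.
move=> psiE x x0; have cU := inv_sq_sum_is_cvg x x0.
set Z := limn (fun n => U n x) in cU.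
have dist h : h != 0 -> `|h| <= x / 2 ->
    `|Z - h^-1 * (psi (h + x) - psi x)| <= `|h| * (2 / x) * Z.
  move=> h0 hx; have hx0 : 0 < h + x.
    by move: hx; rewrite ler_norml => /andP[]; lra.
  (* The terms [ln n%:R] cancel in the difference. *)
  have cT : T n x - T n (h + x) @[n --> \oo] --> psi (h + x) - psi x.
    rewrite (_ : psi (h + x) - psi x = - psi x - - psi (h + x)); last by ring.
    rewrite (_ : (fun n => _) = (fun n => (T n x - ln n%:R) - (T n (h + x) - ln n%:R))).
      exact: (cvgB (psiE _ x0) (psiE _ hx0)).
    by apply/funext => n; ring.
  have cm (a : R) (u : nat -> R) (l : R) : u n @[n --> \oo] --> l -> a * u n @[n --> \oo] --> a * l.
    by move=> ul; exact: (cvgM (cvg_cst a) ul).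
  have lhs := cvg_norm (cvgB cU (cm h^-1 _ _ cT)).
  have rhs := cm (`|h| * (2 / x)) _ _ cU.
  apply: (ler_cvg_to (lhs _ _) rhs); apply: nearW => n; exact: inv_sum_slope.
suff -> : derive1 psi x = Z by [].
rewrite /derive1; apply: cvg_lim => //; apply/cvgrPdist_le => e e0.
have Z0 : 0 <= Z.
  by apply: limr_ge => //; apply: nearW => n; apply: sumr_ge0 => k _; rewrite invr_ge0 sqr_ge0.
(* [c + 1] serves below as a divisor known to be positive. *)
pose c := 2 / x * Z; have c0 : 0 <= c by rewrite mulr_ge0// divr_ge0// ltW.
have c1 : 0 < c + 1 by lra.
near=> h.
have h0 : h != 0 by near: h; exact: nbhs_dnbhs_neq.
have hx : `|h| <= x / 2 by near: h; apply: dnbhs0_le; rewrite divr_gt0.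
have hc : `|h| <= e / (c + 1) by near: h; apply: dnbhs0_le; rewrite divr_gt0.
apply: le_trans (dist _ h0 hx) _; rewrite -mulrA -/c.
apply: (@le_trans _ _ (`|h| * (c + 1))); first by rewrite ler_wpM2l// lerDl.
by rewrite -ler_pdivlMr.
Unshelve. all: by end_near. Qed.

End SquareSeries.

Lemma digamma_cvg (R : realType) (x : R) : 0 < x ->
  \sum_(0 <= k < n) (x + k%:R)^-1 - ln n%:R @[n --> \oo] --> - digamma x.
Proof.
by apply: ln_inv_sum_cvg; [exact: lnGammaS|exact: lnGamma_convex].
Qed.

Lemma trigamma_cvg (R : realType) (x : R) : 0 < x ->
  \sum_(0 <= k < n) (x + k%:R) ^- 2 @[n --> \oo] --> trigamma x.
Proof. by apply: derive1_inv_sum; exact: digamma_cvg. Qed.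

(** * Asymptotics of the sums in the moment formulas *)

Section Asymptotics.
Context {R : realType} {th : R}.
Hypothesis th0 : 0 < th.

Local Notation a n := (\sum_(1 <= i < n) (th + i%:R)^-1).
Local Notation b n := (\sum_(1 <= i < n) (th + i%:R) ^- 2).

Lemma inv_addn_cvg : (th + n%:R)^-1 @[n --> \oo] --> (0 : R).
Proof.
rewrite -cvg_shiftS/=.
apply: (@squeeze_cvgr _ _ _ _ (fun=> 0) (fun n => n.+1%:R^-1)).
- apply: nearW => n; have n0 : 0 < th + n.+1%:R by rewrite ltr_pwDl.
  by rewrite invr_ge0 (ltW n0)/= lef_pV2 ?posrE// lerDr ltW.
- exact: cvg_cst.
- exact: cvg_harmonic.
Qed.

(** The shifted digamma limit at [th + 1] has [n.+1] terms and [a n.+1] only [n]; the surplus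
    [(th + n.+1%:R)^-1] tends to [0]. *)
Lemma inv_sum_cvg : a n.+1 - ln n.+1%:R @[n --> \oo] --> - digamma (th + 1).
Proof.
have := digamma_cvg _ _ (addr_gt0 th0 ltr01); rewrite -cvg_shiftS/= => D.
have := inv_addn_cvg; rewrite -cvg_shiftS/= => I.
rewrite -[X in _ --> X]subr0.
rewrite (_ : (fun n => _) = (fun n =>
  (\sum_(0 <= k < n.+1) (th + 1 + k%:R)^-1 - ln n.+1%:R) - (th + n.+1%:R)^-1)).
  exact: (cvgB D I).
apply/funext => n; rewrite [in RHS]big_nat_recr//= big_add1/=.
under eq_bigr do rewrite -nat1r addrA.
by rewrite -(nat1r n) addrA; ring.
Qed.

Lemma inv_sq_sum_cvg : b n.+1 @[n --> \oo] --> trigamma (th + 1).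
Proof.
rewrite (_ : (fun n => _) = (fun n => \sum_(0 <= k < n) (th + 1 + k%:R) ^- 2)).
  exact: trigamma_cvg (addr_gt0 th0 ltr01).
apply/funext => n; rewrite big_add1/=.
by apply: eq_bigr => i _; rewrite -nat1r addrA.
Qed.

(** Cesàro means of a null sequence, corrected by the term [th^-1] of index [0]. *)
Lemma inv_sum_mean_cvg : n.+1%:R^-1 * a n.+1 @[n --> \oo] --> (0 : R).
Proof.
have M : n.+1%:R^-1 * \sum_(0 <= k < n.+1) (th + k%:R)^-1 @[n --> \oo] --> (0 : R).
  exact: cesaro inv_addn_cvg.
have I : n.+1%:R^-1 * th^-1 @[n --> \oo] --> 0 * th^-1.
  by apply: cvgM; [exact: cvg_harmonic|exact: cvg_cst].
rewrite -[X in _ --> X]subr0 -[X in _ - X](mul0r th^-1).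
rewrite (_ : (fun n => _) = (fun n =>
  n.+1%:R^-1 * (\sum_(0 <= k < n.+1) (th + k%:R)^-1) - n.+1%:R^-1 * th^-1)).
  exact: (cvgB M I).
by apply/funext => n; rewrite [in RHS]big_ltn//= addr0; ring.
Qed.

End Asymptotics.

Theorem theorem2p6 (R : realType) (th : R) : 0 < th ->
  [/\ (forall n : nat, (0 < n)%N ->
         EI th n = (th + (n - 1)%:R) * \sum_(1 <= i < n) (th + i%:R)^-1),
      (fun n : nat =>
         (EI th n - (n%:R * ln (n%:R : R) - digamma (th + 1) * n%:R)) / n%:R)
        @ \oo --> (0 : R),
      (fun n : nat =>
         (VarI th n - (2 / (th + 1) - trigamma (th + 1)) * n%:R ^+ 2) / n%:R ^+ 2)
        @ \oo --> (0 : R),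
      hoppe_martingale th (Mproc th)
    & forall n : nat, (0 < n)%N -> Exp th n (Mproc th n) = 0].
Proof.
move=> th0; have aC := inv_sum_cvg th0; have bC := inv_sq_sum_cvg th0.
have mC := inv_sum_mean_cvg th0.
have hC : n.+1%:R^-1 @[n --> \oo] --> (0 : R) by exact: cvg_harmonic.
split; [exact: EI_sum| | |exact: Mproc_martingale|exact: Mproc_mean].
(* With [n.+1] nodes the weight is [n.+1 + (th - 1)]; its second summand yields the Cesàro term. *)
- rewrite -cvg_shiftS/=; set psi := digamma _ in aC *.
  have : (\sum_(1 <= i < n.+1) (th + i%:R)^-1 - ln n.+1%:R) + psi
      + (th - 1) * (n.+1%:R^-1 * \sum_(1 <= i < n.+1) (th + i%:R)^-1) @[n --> \oo]
      --> - psi + psi + (th - 1) * 0.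
    by apply: cvgD; [apply: cvgD => //; exact: cvg_cst|apply: cvgM => //; exact: cvg_cst].
  rewrite addNr mulr0 addr0; congr (cvg_to (_ @ \oo) _).
  apply/funext => n; rewrite EI_sum// subn1/=.
  have -> : n%:R = n.+1%:R - 1 :> R by rewrite -natr1 addrK.
  by field.
- rewrite -cvg_shiftS/=; set psi1 := trigamma _ in bC *.
  have := inv_addn_cvg th0; rewrite -cvg_shiftS/= => dC.
  (* [r n] is the ratio of the total weight [th + n%:R] to [n.+1%:R]. *)
  pose r n : R := 1 + (th - 1) * n.+1%:R^-1.
  have rC : r n @[n --> \oo] --> (1 : R).
    rewrite -[X in _ --> X]addr0 -(mulr0 (th - 1)).
    by apply: cvgD; [exact: cvg_cst|apply: cvgM => //; exact: cvg_cst].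
  pose k := (1 - th) / (1 + th).
  have t1 : 1 + th != 0 by rewrite gt_eqF// addr_gt0.
  (* The closed variance divided by [n.+1%:R ^+ 2]: the two leading multiples of the harmonic-type
     sum cancel, leaving it only divided by [n.+1%:R]. *)
  have : r n * r n * (1 + k - \sum_(1 <= i < n.+1) (th + i%:R) ^- 2)
      + r n * (k * n.+1%:R^-1 - n.+1%:R^-1 * \sum_(1 <= i < n.+1) (th + i%:R)^-1)
      - (r n * r n + r n * n.+1%:R^-1) * (th + n.+1%:R)^-1
      - (2 / (th + 1) - psi1) @[n --> \oo]
      --> 1 * 1 * (1 + k - psi1) + 1 * (k * 0 - 0) - (1 * 1 + 1 * 0) * 0
          - (2 / (th + 1) - psi1).
    apply: cvgB; last exact: cvg_cst.
    apply: cvgB.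
      apply: cvgD.
        apply: cvgM; first exact: cvgM.
        by apply: cvgB => //; exact: cvg_cst.
      apply: cvgM => //; apply: cvgB => //.
      by apply: cvgM => //; exact: cvg_cst.
    by apply: cvgM => //; apply: cvgD => //; exact: cvgM.
  (* Holds because [1 + k = 2 / (th + 1)]. *)
  have -> : 1 * 1 * (1 + k - psi1) + 1 * (k * 0 - 0) - (1 * 1 + 1 * 0) * 0
      - (2 / (th + 1) - psi1) = 0 by rewrite /k; field; rewrite addrC t1.
  congr (cvg_to (_ @ \oo) _).
  apply/funext => n; rewrite VarI_closed// -/k !subn1/= /r.
  have w0 := weight_neq0 th0 n.+1; have w1 := weight_neq0 th0 n.+2.
  move: w0 w1; rewrite !subn1/=.
  have -> : n%:R = n.+1%:R - 1 :> R by rewrite -natr1 addrK.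
  have : n.+1%:R != 0 :> R by [].
  move: n.+1%:R (\sum_(1 <= i < n.+1) _) (\sum_(1 <= i < n.+1) _) => N A B N0 w0 w1.
  by field; rewrite N0 w0 w1 addrC t1.
Qed.
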